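(* Let $B$ be a symmetric matrix over a field of characteristic $2$, with $\operatorname{epr}(B)=\ell_1\ell_2\cdots\ell_n$. Suppose $\ell_1\neq\mathtt{N}$. If $\ell_k=\mathtt{N}$ for some $k$, then $\ell_j=\mathtt{N}$ for all $j\geq k$ (with $j\le n$).
   Context: For an $n\times n$ symmetric matrix $B$ over a field $\mathbb{F}$, the enhanced principal rank characteristic sequence (epr-sequence) is $\operatorname{epr}(B)=\ell_1\ell_2\cdots\ell_n$, where $\ell_k=\mathtt{A}$ if all principal minors of $B$ of order $k$ are nonzero, $\ell_k=\mathtt{S}$ if some but not all principal minors of order $k$ are nonzero, and $\ell_k=\mathtt{N}$ if all principal minors of order $k$ are zero. *)

(* Defs.v *)
From mathcomp Require Import all_boot all_order all_algebra.

Set Implicit Arguments.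
Unset Strict Implicit.
Unset Printing Implicit Defensive.

Import GRing.Theory.
Local Open Scope ring_scope.

Inductive epr_symbol : Type := eprA | eprS | eprN.

(* The minor on the rows and columns indexed by [a], taken in increasing
   order; its order is [#|a|]. *)
Definition principal_minor (F : fieldType) (n : nat) (B : 'M[F]_n)
    (a : {set 'I_n}) : F :=
  \det (mxsub (fun i : 'I_#|a| => enum_val i) (fun i : 'I_#|a| => enum_val i) B).

(* Meaningful for 1 <= k <= n, where at least one principal minor of order k
   exists, so the three cases are mutually exclusive. *)
Definition epr_term (F : fieldType) (n : nat) (B : 'M[F]_n) (k : nat) :
    epr_symbol :=
  if [forall (a : {set 'I_n} | #|a| == k), principal_minor B a != 0] then eprA
  else if [exists (a : {set 'I_n} | #|a| == k), principal_minor B a != 0]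
  then eprS
  else eprN.

(* The entry of the tuple at position i (from 0) is the term of index i + 1. *)
Definition epr (F : fieldType) (n : nat) (B : 'M[F]_n) : n.-tuple epr_symbol :=
  [tuple epr_term B i.+1 | i < n].

(* Main.v *)
Require Import Defs.
From mathcomp Require Import all_boot all_order all_algebra.
From mathcomp Require Import perm.

Set Implicit Arguments.
Unset Strict Implicit.
Unset Printing Implicit Defensive.

Import GRing.Theory.
Local Open Scope ring_scope.

(** In characteristic 2 a quadratic form sees only the diagonal of its matrix.
    Comparing diagonal entries in D adj(D) D = det(D) D, for D symmetric, gives
      det(D) D_qq = \sum_i M_i D_qi^2,   M_i the minor of D deleting row and column i.
    Suppose all principal minors of order k vanish and the principal submatrix C
    of order k + 1 is nonsingular.  The identity for C shows that C has zero
    diagonal, so a nonzero diagonal entry b lies outside C; let D be C bordered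
    by that index 0.  For p <> 0 the identity for D without p gives M_p = 0, so
    the identity for D reduces to det(D) D_qq = det(C) D_q0^2.  Hence
    det(D) = b det(C) is nonzero, and D_r0 = 0 for r <> 0.  Adding 1 to D_rr
    changes neither det(D) nor any M_p with p <> 0 (all these changes are
    principal minors already known to vanish), so the identity for the modified
    matrix reads det(D) = M'_0 D_r0^2 = 0, a contradiction. *)

(** Injective maps replace sets of indices: they compose, so submatrices inherit the property, and
    no enumeration of a set is needed. *)
Definition principal_minors_vanish (F : fieldType) (n k : nat) (B : 'M[F]_n) :=
  forall f : 'I_k -> 'I_n, injective f -> \det (mxsub f f B) = 0.

(** The terms at [(i, j)] and [(j, i)] are equal, so off the diagonal they cancel in pairs. *)
Lemma sum_sym_pchar2 (R : comNzRingType) (n : nat) (S : 'I_n -> 'I_n -> R) :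
    2%N \in [pchar R] -> (forall i j, S i j = S j i) ->
  \sum_i \sum_j S i j = \sum_i S i i.
Proof.
move=> ch2 symS.
have split_row (i : 'I_n) : \sum_j S i j =
    S i i + (\sum_(j : 'I_n | (i < j)%N) S i j + \sum_(j : 'I_n | (j < i)%N) S i j).
  rewrite (bigD1 i) //= (bigID (fun j : 'I_n => (i < j)%N)) /=; congr (_ + (_ + _)).
    by apply: eq_bigl => j; rewrite -val_eqE /=; case: ltngtP.
  by apply: eq_bigl => j; rewrite -val_eqE /=; case: ltngtP.
under eq_bigr do rewrite split_row.
rewrite big_split big_split /=.
rewrite [X in _ + (_ + X)](exchange_big_dep xpredT) //=.
under [X in _ + (_ + X)]eq_bigr do under eq_bigr do rewrite symS.
by rewrite addrr_pchar2 ?addr0.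
Qed.

Lemma cofactor_diag (R : comNzRingType) (n : nat) (A : 'M[R]_n) (i : 'I_n) :
  cofactor A i i = \det (row' i (col' i A)).
Proof. by rewrite /cofactor addnn -signr_odd odd_double expr0 mul1r. Qed.

Lemma det_diag_pchar2 (R : comNzRingType) (n : nat) (D : 'M[R]_n) (q : 'I_n) :
    2%N \in [pchar R] -> D^T = D ->
  \det D * D q q = \sum_i cofactor D i i * D q i ^+ 2.
Proof.
move=> ch2 symD.
have DT i j : D i j = D j i by rewrite -{1}symD mxE.
have adjT i j : (\adj D) i j = (\adj D) j i.
  by rewrite -{1}symD -trmx_adj mxE.
have -> : \det D * D q q = (D *m (\adj D *m D)) q q.
  by rewrite mul_adj_mx mul_mx_scalar mxE.
rewrite mxE; under eq_bigr do rewrite mxE big_distrr /=.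
(* The summand D_qi adj(D)_ij D_jq is symmetric in i and j. *)
rewrite sum_sym_pchar2 // => [|i j]; last first.
  by rewrite adjT (DT q i) (DT j q) mulrC -mulrA mulrCA.
by apply: eq_bigr => i _; rewrite (DT i q) mxE mulrCA expr2.
Qed.

(** In the expansion along row [r] the cofactors do not see that row, so only the coefficient at [r]
    changes. *)
Lemma det_add_delta (R : comNzRingType) (n : nat) (A : 'M[R]_n) (r : 'I_n) :
  \det (A + delta_mx r r) = \det A + cofactor A r r.
Proof.
rewrite (expand_det_row _ r) (expand_det_row A r).
have cofE j : cofactor (A + delta_mx r r) r j = cofactor A r j.
  congr (_ * \det _); apply/matrixP=> x y.
  by rewrite !mxE eq_sym (negPf (neq_lift _ _)) addr0.
under eq_bigr do rewrite cofE !mxE eqxx /= mulrDl.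
rewrite big_split /=; congr (_ + _).
rewrite (bigD1 r) //= eqxx mul1r big1 ?addr0 // => j /negPf ->.
by rewrite mul0r.
Qed.

Lemma mxsub_sym (R : Type) (m n : nat) (f : 'I_m -> 'I_n) (B : 'M[R]_n) :
  B^T = B -> (mxsub f f B)^T = mxsub f f B.
Proof. by move=> symB; rewrite trmx_mxsub symB. Qed.

Section Vanishing.

Variables (F : fieldType) (ch2 : 2%N \in [pchar F]).

Lemma principal_minors_vanish_mxsub (m n k : nat) (B : 'M[F]_n) (g : 'I_m -> 'I_n) :
    injective g -> principal_minors_vanish k B ->
  principal_minors_vanish k (mxsub g g B).
Proof.
move=> injg vB f injf; rewrite -mxsub_comp.
by apply: vB; apply: inj_comp.
Qed.

Lemma cofactor_vanish (k : nat) (C : 'M[F]_k.+1) (p : 'I_k.+1) :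
  principal_minors_vanish k C -> cofactor C p p = 0.
Proof.
move=> vC; rewrite cofactor_diag -(vC _ (@lift_inj _ p)).
by congr (\det _); apply/matrixP=> i j; rewrite !mxE.
Qed.

Lemma det_diag_vanish (k : nat) (C : 'M[F]_k.+1) (q : 'I_k.+1) :
  C^T = C -> principal_minors_vanish k C -> \det C * C q q = 0.
Proof.
move=> symC vC; rewrite det_diag_pchar2 // big1 // => i _.
by rewrite cofactor_vanish ?mul0r.
Qed.

Lemma bordered_cofactor0 (k : nat) (D : 'M[F]_k.+2) :
    D^T = D -> principal_minors_vanish k D ->
    (forall r, r != ord0 -> D r r = 0) -> D ord0 ord0 != 0 ->
  cofactor D ord0 ord0 = 0.
Proof.
move=> symD vD diag0 b0; apply: contraTeq isT => c0 /=.
have D_E (A : 'M[F]_k.+2) p : row' p (col' p A) = mxsub (lift p) (lift p) A.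
  by apply/matrixP=> i j; rewrite !mxE.
have vDp p : principal_minors_vanish k (row' p (col' p D)).
  by rewrite D_E; apply: principal_minors_vanish_mxsub => //; apply: lift_inj.
have Mp p : p != ord0 -> cofactor D p p = 0.
  move=> p0; rewrite cofactor_diag; apply/eqP.
  (* Since [p] is not 0, index 0 survives in [D] without [p], as [z], and its diagonal entry there
     is nonzero. *)
  case: (unliftP p ord0) => [z z0 | e]; last by rewrite e eqxx in p0.
  have := det_diag_vanish z _ (vDp p); rewrite {1 2}D_E mxsub_sym // => /(_ erefl).
  by rewrite !mxE -z0 => /eqP; rewrite mulf_eq0 (negPf b0) orbF.
have quad (A : 'M[F]_k.+2) q : A^T = A ->
    (forall p, p != ord0 -> cofactor A p p = 0) ->
    \det A * A q q = cofactor A ord0 ord0 * A q ord0 ^+ 2.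
  move=> symA cofA; rewrite det_diag_pchar2 // (bigD1 ord0) //= big1 ?addr0 //.
  by move=> i /cofA ->; rewrite mul0r.
have detD : \det D != 0.
  apply: contraNneq c0 => d0; have := quad D ord0 symD Mp.
  by rewrite d0 mul0r => /esym/eqP; rewrite mulf_eq0 expf_eq0 /= (negPf b0) orbF.
(* Any index other than 0 would serve; one exists because [D] has order at least 2. *)
pose r : 'I_k.+2 := lift ord0 ord0.
have r0 : r != ord0 by [].
have xr : D r ord0 = 0.
  have := quad D r symD Mp; rewrite diag0 // mulr0 => /esym/eqP.
  by rewrite mulf_eq0 (negPf c0) expf_eq0 /= => /eqP.
have symD' : (D + delta_mx r r)^T = D + delta_mx r r.
  by rewrite linearD /= symD trmx_delta.
have Mp' p : p != ord0 -> cofactor (D + delta_mx r r) p p = 0.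
  move=> p0; have := Mp p p0; rewrite !cofactor_diag => dp.
  (* Unless [p] is [r], deleting [p] keeps the added 1, which contributes a principal minor of order
     [k], hence 0. *)
  case: (unliftP p r) => [r' er' | er].
    have -> : row' p (col' p (D + delta_mx r r)) =
              row' p (col' p D) + delta_mx r' r'.
      apply/matrixP=> i j; rewrite !mxE er'.
      by rewrite !(inj_eq lift_inj).
    by rewrite det_add_delta dp cofactor_vanish ?addr0.
  rewrite -[RHS]dp; congr (\det _); apply/matrixP=> i j.
  by rewrite !mxE er eq_sym (negPf (neq_lift _ _)) addr0.
have := quad _ r symD' Mp'.
rewrite det_add_delta Mp // !mxE diag0 // xr !eqxx /= !addr0 add0r mulr1.
by rewrite expr0n mulr0 => /eqP; rewrite (negPf detD).
Qed.

Lemma principal_minors_vanishS (n k : nat) (B : 'M[F]_n) (i : 'I_n) :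
    B^T = B -> B i i != 0 -> principal_minors_vanish k B ->
  principal_minors_vanish k.+1 B.
Proof.
move=> symB bi vB f injf; apply/eqP; apply: contraTT isT => dC /=.
have diagC q : B (f q) (f q) = 0.
  have vC := principal_minors_vanish_mxsub injf vB.
  have := det_diag_vanish q (mxsub_sym f symB) vC.
  by move/eqP; rewrite mulf_eq0 (negPf dC) mxE => /eqP.
(* [g] enumerates the bordered matrix: 0 goes to the new index [i], the others follow [f]. *)
pose g (j : 'I_k.+2) := oapp f i (unlift ord0 j).
have g0 : g ord0 = i by rewrite /g unlift_none.
have gl j : g (lift ord0 j) = f j by rewrite /g liftK.
have fi q : f q != i by apply: contraNneq bi => <-; rewrite diagC.
have injg : injective g.
  move=> x y; case: (unliftP ord0 x) => [x'|] ->; case: (unliftP ord0 y) => [y'|] ->;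
    rewrite ?g0 ?gl //.
  - by move/injf->.
  - by move/eqP; rewrite (negPf (fi _)).
  - by move/esym/eqP; rewrite (negPf (fi _)).
have := bordered_cofactor0 (mxsub_sym g symB) (principal_minors_vanish_mxsub injg vB).
rewrite cofactor_diag.
have -> : row' ord0 (col' ord0 (mxsub g g B)) = mxsub f f B.
  by apply/matrixP=> x y; rewrite !mxE !gl.
rewrite mxE g0 => h; case/eqP: dC; apply: h => // r.
by case: (unliftP ord0 r) => [r'|] ->; rewrite ?eqxx // mxE gl diagC.
Qed.

End Vanishing.

Lemma det_mxsub_perm (R : comNzRingType) (n : nat) (A : 'M[R]_n) (s : {perm 'I_n}) :
  \det (mxsub s s A) = \det A.
Proof.
have -> : mxsub s s A = row_perm s (col_perm s A).
  by apply/matrixP=> i j; rewrite !mxE.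
rewrite row_permE col_permE !det_mulmx !det_perm odd_permV.
by rewrite mulrCA -signr_addb addbb mulr1.
Qed.

(** [f] may list its image in another order than [enum_val]; reordering rows and columns alike
    preserves the determinant. *)
Lemma principal_minor_image (F : fieldType) (n k : nat) (B : 'M[F]_n)
    (f : 'I_k -> 'I_n) :
  injective f -> principal_minor B [set f i | i : 'I_k] = \det (mxsub f f B).
Proof.
move=> injf; set a := [set _ | _ in _].
have card_a : #|a| = k by rewrite card_imset // card_ord.
have fa (i : 'I_#|a|) : f (cast_ord card_a i) \in a by apply: imset_f.
pose h (i : 'I_#|a|) := enum_rank_in (fa i) (f (cast_ord card_a i)).
have hK i : enum_val (h i) = f (cast_ord card_a i) by rewrite enum_rankK_in.
have injh : injective h.
  by move=> x y e; apply/(@cast_ord_inj _ _ card_a)/injf; rewrite -!hK e.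
rewrite /principal_minor -(det_mxsub_perm _ (perm injh)).
have -> : mxsub (perm injh) (perm injh)
    (@mxsub F n n #|a| #|a| enum_val enum_val B) =
    mxsub (f \o cast_ord card_a) (f \o cast_ord card_a) B.
  by apply/matrixP=> x y; rewrite !mxE !permE !hK.
(* Generalising [#|a|] to a variable lets the equality with [k] be eliminated, which removes the
   casts. *)
move: card_a {fa h hK injh}; move: #|a| => m e; case: _ / e in f injf a *.
by congr (\det _); apply/matrixP=> x y; rewrite !mxE /= !cast_ord_id.
Qed.

(** The bound guarantees a principal minor of order [k]; without one [epr_term] would be [eprA]
    vacuously. *)
Lemma epr_termN (F : fieldType) (n k : nat) (B : 'M[F]_n) :
  (k <= n)%N -> epr_term B k = eprN <-> principal_minors_vanish k B.
Proof.
move=> lekn; rewrite /epr_term; split=> [|vB].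
  case: ifP => // _; case: existsP => // nex _ f injf.
  rewrite -principal_minor_image //; apply/eqP/negPn/negP => nz.
  by apply: nex; exists [set f i | i : 'I_k]; rewrite card_imset // card_ord eqxx.
have pm0 (a : {set 'I_n}) : #|a| == k -> principal_minor B a = 0.
  by move/eqP=> ak; case: _ / ak in vB *; apply: vB; apply: enum_val_inj.
case: forallP => [all_nz|_]; last first.
  by case: existsP => // -[a /andP[/pm0 ->]]; rewrite eqxx.
(* The first [k] indices form a set refuting the case [eprA]. *)
have inj_w : injective (widen_ord lekn) by move=> x y /(congr1 val)/= /val_inj.
have ca : #|[set widen_ord lekn i | i : 'I_k]| == k by rewrite card_imset // card_ord.
by have := all_nz [set widen_ord lekn i | i : 'I_k]; rewrite ca pm0 // eqxx.
Qed.

Theorem mainTheorem6 (F : fieldType) (charF2 : 2%N \in [pchar F])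
    (n : nat) (B : 'M[F]_n) (symB : B^T = B)
    (l : nat -> epr_symbol) (eprB : epr B = [tuple l i.+1 | i < n])
    (l1 : l 1%N <> eprN)
    (k : nat) (hk : (1 <= k <= n)%N) (lk : l k = eprN) :
  forall j : nat, (k <= j <= n)%N -> l j = eprN.
Proof.
have lE j : (0 < j <= n)%N -> l j = epr_term B j.
  case: j => // j /= ltjn; have := congr1 (fun t => tnth t (Ordinal ltjn)) eprB.
  by rewrite !tnth_mktuple.
case/andP: hk => k0 kn; have n0 := leq_trans k0 kn.
have [i bi] : exists i, B i i != 0.
  (* Otherwise all minors of order 1, the diagonal entries, vanish and [l 1] is [eprN]. *)
  apply/existsP; apply: contra_notT l1; rewrite negb_exists => /forallP Bz.
  rewrite lE //; apply/(epr_termN B n0) => f _; rewrite det_mx11 mxE.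
  by apply/eqP/negPn.
have vk : principal_minors_vanish k B by apply/(epr_termN B kn); rewrite -lE ?k0.
move=> j /andP[kj jn]; rewrite lE ?(leq_trans k0 kj) //; apply/(epr_termN B jn).
rewrite -(subnK kj); elim: (j - k)%N => // d IHd.
by rewrite addSn; apply: principal_minors_vanishS bi IHd.
Qed.
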